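(* Let $T_1$ be an oriented tree and $P_2$ an oriented path with $T_1<P_2$ in the homomorphism order. If $h(P_2)\ge 4$, then there exists an oriented tree $T$ with $T_1<T<P_2$.
   Context: All digraphs are finite. A homomorphism $f:G_1\to G_2$ between digraphs is a map $V(G_1)\to V(G_2)$ sending arcs to arcs; write $G_1\le G_2$ if one exists, and $G_1<G_2$ if $G_1\le G_2$ and $G_2\not\le G_1$. An oriented path is a digraph whose vertices can be listed $p_0,\dots,p_n$ so that its arcs are exactly one arc between $p_{i-1}$ and $p_i$ (in either direction) for each $i$; an oriented tree is an orientation of a finite tree. $\vec P_k$ denotes the directed path with vertices $0,\dots,k$ and arcs $01,12,\dots,(k-1)k$. The height $h(P)$ of an oriented path $P$ is the minimum $k\ge0$ with $P\to\vec P_k$. *)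

(* Defs.v *)
From mathcomp Require Import all_boot.
Set Implicit Arguments. Unset Strict Implicit. Unset Printing Implicit Defensive.

Record digraph := Digraph { dvert : finType; darc : rel dvert }.

Definition hom (G1 G2 : digraph) : Prop :=
  exists f : dvert G1 -> dvert G2,
    forall x y, darc x y -> darc (f x) (f y).
Definition hle (G1 G2 : digraph) : Prop := hom G1 G2.
Definition hlt (G1 G2 : digraph) : Prop := hom G1 G2 /\ ~ hom G2 G1.

Definition uadj (G : digraph) : rel (dvert G) :=
  fun x y => darc x y || darc y x.

Definition oriented (G : digraph) : Prop :=
  forall x y : dvert G, ~~ (darc x y && darc y x).

Definition oriented_tree (G : digraph) : Prop :=
  [/\ oriented G,
      0 < #|dvert G|,
      (forall x y : dvert G, connect (@uadj G) x y) &
      (forall c : seq (dvert G), 3 <= size c -> ~ ucycle (@uadj G) c)].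

Definition oriented_path (G : digraph) : Prop :=
  exists (n : nat) (p : 'I_n.+1 -> dvert G),
    [/\ bijective p,
        (forall i : 'I_n.+1, forall Hi : (i.+1 < n.+1)%N,
           let j := Ordinal Hi in
           (darc (p i) (p j) (+) darc (p j) (p i))) &
        (forall x y : dvert G, darc x y ->
           exists i : 'I_n.+1, exists Hi : (i.+1 < n.+1)%N,
             let j := Ordinal Hi in
             ((x == p i) && (y == p j)) || ((x == p j) && (y == p i)))].

Definition dipath (k : nat) : digraph :=
  @Digraph ('I_k.+1) (fun i j => (nat_of_ord j == (nat_of_ord i).+1)).

Definition height (P : digraph) (k : nat) : Prop :=
  hom P (dipath k) /\ forall k', hom P (dipath k') -> (k <= k')%N.

(* Main.v *)
(** Replace [P2] by a core [P = p_0 ... p_n], whose only endomorphisms are the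
    identity and possibly the reversal. A tree over [P] contains no section of
    [P] exactly when it maps to the ladder [G]: the path [P] minus its last vertex, the
    path [P] minus its first vertex, and rungs joining the copy of [p_j] in the
    second to the copy of [p_(j+1)] in the first. Hence [T1 -> G] and not [P -> G], and
    every tree obtained from [T1] by attaching trees over [G] is at least [T1]
    and strictly below [P].

    Height at least 4 provides a directed subpath [p_i p_(i+1) p_(i+2)] avoiding
    both ends of [P], hence a square [a b d c] of [G] over it. Unroll this square
    into a long zigzag, with a final segment of [P] planted at each [b] and an
    initial one at each [c]. In a tree that does not receive [P] no [b] is
    identified with a neighbouring [c], so the image of the zigzag never backtracks
    and is a path; a zigzag longer than [T1] therefore does not map to [T1]. *)

Require Import Defs.
From Stdlib Require Import Classical_Prop.
From mathcomp Require Import all_boot zify.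
Set Implicit Arguments. Unset Strict Implicit. Unset Printing Implicit Defensive.

(** * Homomorphisms and steps along arcs in either direction *)

Definition is_hom (X Y : digraph) (f : dvert X -> dvert Y) : Prop :=
  forall x y, darc x y -> darc (f x) (f y).

Definition step (X : digraph) (d : bool) (x y : dvert X) : bool :=
  if d then darc x y else darc y x.

Lemma hom_trans (X Y Z : digraph) : hom X Y -> hom Y Z -> hom X Z.
Proof. by move=> [f Hf] [g Hg]; exists (g \o f) => x y /Hf /Hg. Qed.

Lemma step_hom (X Y : digraph) (f : dvert X -> dvert Y) d x y :
  is_hom f -> step d x y -> step d (f x) (f y).
Proof. by move=> Hf; case: d => /Hf. Qed.

Lemma step_uadj (X : digraph) d (x y : dvert X) : step d x y -> uadj x y.
Proof. by rewrite /uadj; case: d => /= ->; rewrite ?orbT. Qed.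

Lemma uadjP (X : digraph) (x y : dvert X) :
  reflect (exists d, step d x y) (uadj x y).
Proof.
apply: (iffP orP) => [[H|H]|[[] H]]; [by exists true|by exists false|by left|by right].
Qed.

Lemma step_negb (X : digraph) d (x y : dvert X) : step (~~ d) x y = step d y x.
Proof. by case: d. Qed.

Lemma uadj_sym (X : digraph) : symmetric (@uadj X).
Proof. by move=> x y; rewrite /uadj orbC. Qed.

Lemma step_asym (X : digraph) d (x y : dvert X) :
  oriented X -> step d x y -> step d y x -> False.
Proof.
by move=> ori; case: d => /= H1 H2; have := ori x y; rewrite H1 H2.
Qed.

(** * Non-backtracking walks in a tree *)

(** By pigeonhole the walk revisits a vertex. Two visits at minimal distance [d] close a cycle, as
    [d = 1] would be a loop and [d = 2] a backtrack. *)
Lemma no_long_nonbacktracking_walk (T : digraph) (w : nat -> dvert T) N :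
  oriented_tree T -> #|dvert T| <= N ->
  (forall j, j < N -> uadj (w j) (w j.+1)) ->
  (forall j, j.+2 <= N -> w j <> w j.+2) -> False.
Proof.
move=> [ori _ _ acyc] cardT adjw nbw.
have exd : exists d, (0 < d) && [exists i : 'I_N.+1, (i + d <= N) && (w i == w (i + d))].
  have /injectivePn [i [j neq_ij eqw]] :
      ~~ injectiveb (fun i : 'I_N.+1 => w i).
    apply/negP => /injectiveP inj; have := leq_card _ inj.
    by rewrite card_ord; lia.
  have {neq_ij} : (i != j :> nat) by [].
  wlog ij : i j eqw / i < j => [W|] neq_ij.
    by case: (ltngtP i j) neq_ij => // H _; [apply: (W i j)|apply: (W j i)] => //; lia.
  exists (j - i); rewrite subn_gt0 ij; apply/existsP; exists i.
  by rewrite subnKC ?(ltnW ij) // -ltnS ltn_ord eqw eqxx.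
case: (ex_minnP exd) => d /andP[d0 /existsP[i /andP[iN /eqP eqw]]] dmin.
have d1 : d != 1.
  apply/eqP => d1; have Hi : i < N by lia.
  move: (adjw _ Hi) eqw; rewrite d1 addn1 /uadj => + eqw; rewrite -eqw orbb => H.
  by have := ori (w i) (w i); rewrite H.
have d2 : d != 2.
  apply/eqP => d2; have Hi : i.+2 <= N by lia.
  by apply: (nbw _ Hi); rewrite eqw d2 addn2.
apply: (acyc [seq w (i + m) | m <- iota 0 d]); first by rewrite size_map size_iota; lia.
apply/andP; split.
  case: d d0 iN eqw {dmin d1 d2} => // d _ iN eqw /=.
  rewrite addn0 rcons_path; apply/andP; split.
    have: forall k m, i + (k + m) <= N ->
        path (@uadj T) (w (i + m)) [seq w (i + m0) | m0 <- iota m.+1 k].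
      elim=> // k IH m H /=; rewrite IH ?andbT; last by lia.
      by rewrite addnS; apply: adjw; lia.
    by move=> /(_ d 0); rewrite !addn0; apply; lia.
  have -> : last (w i) [seq w (i + m) | m <- iota 1 d] = w (i + d).
    have E k : forall m,
        last (w (i + m)) [seq w (i + m0) | m0 <- iota m.+1 k] = w (i + (m + k)).
      by elim: k => [|k IH] m /=; rewrite ?addn0 // IH addSnnS.
    by have := E d 0; rewrite addn0 add0n.
  by rewrite eqw addnS; apply: adjw; lia.
rewrite map_inj_in_uniq ?iota_uniq // => a b.
rewrite !mem_iota !add0n /= => Ha Hb eqab.
have key : forall a b, a < b < d -> w (i + a) = w (i + b) -> False.
  move=> {Ha Hb eqab} a' b' /andP[ab bd] eqab.
  have Hi : i + a' < N.+1 by lia.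
  have : d <= b' - a'.
    apply: dmin; rewrite subn_gt0 ab; apply/existsP; exists (Ordinal Hi) => /=.
    by rewrite -addnA subnKC ?(ltnW ab) // eqab eqxx andbT; lia.
  by lia.
by case: (ltngtP a b) => // H; [case: (key a b)|case: (key b a)]; rewrite ?H.
Qed.

(** * Attaching trees by adding leaves *)

Definition add_leaf (S : digraph) (x0 : dvert S) (d : bool) : digraph :=
  @Digraph (option (dvert S)) (fun u v =>
    match u, v with
    | Some x, Some y => darc x y
    | Some x, None => d && (x == x0)
    | None, Some y => ~~ d && (y == x0)
    | None, None => false
    end).

Lemma uadj_add_leaf (S : digraph) (x0 : dvert S) d x :
  @uadj (add_leaf x0 d) None (Some x) = (x == x0).
Proof. by rewrite /uadj /=; case: d; rewrite ?orbF. Qed.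

Lemma step_add_leaf (S : digraph) (x0 : dvert S) d :
  @step (add_leaf x0 d) d (Some x0) None.
Proof. by case: d => /=; rewrite eqxx. Qed.

(** A cycle through the leaf would meet [x0], its only neighbour, on both sides. *)
Lemma add_leaf_tree (S : digraph) (x0 : dvert S) d :
  oriented_tree S -> oriented_tree (add_leaf x0 d).
Proof.
move=> [ori S0 con acyc]; split.
- by move=> [x|] [y|] //=; case: d; rewrite ?andbF.
- by rewrite /= card_option.
- have conS x y : connect (@uadj (add_leaf x0 d)) (Some x) (Some y).
    have /connectP[p pth ->] := con x y.
    apply/connectP; exists (map Some p); last by rewrite last_map.
    by rewrite (mono_path (e := @uadj S)).
  have conN x : connect (@uadj (add_leaf x0 d)) None (Some x).
    by apply: connect_trans (conS x0 x); apply: connect1; rewrite uadj_add_leaf.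
  move=> [x|] [y|] //.
  by rewrite (sym_connect_sym (@uadj_sym _)); exact: conN.
- move=> c sz /andP[cyc unq].
  have [Nc|Nc] := boolP (None \in c).
    case/rot_to: Nc => i c' rotc.
    move: cyc unq sz; rewrite -(rot_cycle i) -(rot_uniq i) -(size_rot i) rotc.
    case: c' {rotc} => [|[z|] [|z' q]] //=; rewrite ?inE //.
    rewrite uadj_add_leaf => /andP[/eqP-> /andP[_]].
    rewrite rcons_path uadj_sym => /andP[_].
    case E: (last z' q) => [y|] //; rewrite uadj_add_leaf => /eqP Ey.
    move: (mem_last z' q); rewrite E Ey => Hin /and3P[_ /negP H _] _.
    by apply: H.
  have Ec : c = map Some (pmap id c).
    elim: c Nc {cyc unq sz} => [|[x|] c IH] //=; rewrite inE //= => /IH {1}->.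
    by [].
  apply: (acyc (pmap id c)); first by rewrite -(size_map Some) -Ec.
  rewrite Ec in cyc unq.
  apply/andP; split; last by rewrite (map_inj_uniq Some_inj) in unq.
  by rewrite (mono_cycle (e := @uadj S)) in cyc.
Qed.

(* [FNode phi d psi] is the rooted tree [phi] whose root has received a further
   child, along an arc of direction [d], carrying [psi]; [sat phi x] says that
   the tree maps into [X] with its root sent to [x]. *)
Inductive ftree := FLeaf | FNode of ftree & bool & ftree.

Fixpoint sat (X : digraph) (phi : ftree) (x : dvert X) : bool :=
  match phi with
  | FLeaf => true
  | FNode phi d psi => sat phi x && [exists y, step d x y && sat psi y]
  end.

Lemma sat_node (X : digraph) phi d psi (x y : dvert X) :
  sat phi x -> step d x y -> sat psi y -> sat (FNode phi d psi) x.
Proof. by move=> /= -> H1 H2; apply/existsP; exists y; rewrite H1. Qed.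

Lemma sat_nodeP (X : digraph) phi d psi (x : dvert X) :
  sat (FNode phi d psi) x -> sat phi x /\ exists2 y, step d x y & sat psi y.
Proof. by move=> /= /andP[-> /existsP[y /andP[? ?]]]; split=> //; exists y. Qed.

Lemma sat_hom (X Y : digraph) (f : dvert X -> dvert Y) phi x :
  is_hom f -> sat phi x -> sat phi (f x).
Proof.
move=> Hf; elim: phi x => // phi IH1 d psi IH2 x /sat_nodeP[/IH1 H1 [y xy /IH2 H2]].
exact: sat_node H1 (step_hom Hf xy) H2.
Qed.

(** [U] is [S] with [phi] glued freely at [x0]; the last clause is the resulting extension
    property. *)
Lemma attach_tree (phi : ftree) (S : digraph) (x0 : dvert S) :
  oriented_tree S ->
  exists (U : digraph) (io : dvert S -> dvert U),
    [/\ oriented_tree U, is_hom io, sat phi (io x0) &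
        forall (X : digraph) (g : dvert S -> dvert X), is_hom g -> sat phi (g x0) ->
          exists2 g' : dvert U -> dvert X, is_hom g' & forall x, g' (io x) = g x].
Proof.
elim: phi S x0 => [|phi IH1 d psi IH2] S x0 tS.
  exists S, id; split=> // X g Hg _; by exists g.
have [U1 [io1 [tU1 Hio1 sat1 ext1]]] := IH1 S x0 tS.
pose U2 := add_leaf (io1 x0) d.
have tU2 : oriented_tree U2 by exact: add_leaf_tree.
have HSome : @is_hom U1 U2 Some by move=> x y.
have [U3 [io3 [tU3 Hio3 sat3 ext3]]] := IH2 U2 None tU2.
exists U3, (fun x => io3 (Some (io1 x))); split=> //.
- by move=> x y /Hio1 /HSome /Hio3.
- apply: (sat_node (y := io3 None)) => //.
    by apply: (sat_hom Hio3); apply: (sat_hom HSome).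
  exact/(step_hom Hio3)/step_add_leaf.
- move=> X g Hg /sat_nodeP[sphi [y xy spsi]].
  have [g1 Hg1 g1E] := ext1 X g Hg sphi.
  pose g2 (u : dvert U2) := if u is Some x then g1 x else y.
  have Hg2 : is_hom g2.
    move=> [u|] [v|] //=; first exact: Hg1.
      by case/andP=> dT /eqP->; rewrite g1E; rewrite dT in xy.
    by case/andP=> /negbTE dF /eqP->; rewrite g1E; rewrite dF in xy.
  have [g3 Hg3 g3E] := ext3 X g2 Hg2 spsi.
  by exists g3 => // x; rewrite g3E /= g1E.
Qed.

(** * Oriented paths as direction sequences *)

Definition spath (n : nat) (s : nat -> bool) : digraph :=
  @Digraph 'I_n.+1 (fun i j =>
    ((j == i.+1 :> nat) && s i) || ((i == j.+1 :> nat) && ~~ s j)).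

Lemma step_spath n s (i j : 'I_n.+1) :
  j = i.+1 :> nat -> @step (spath n s) (s i) i j.
Proof. by move=> ij; rewrite /step /= ij eqxx; case: (s i); rewrite //= orbT. Qed.

Lemma hom_spathP n s (X : digraph) :
  hom (spath n s) X <->
  exists q : nat -> dvert X, forall i, i < n -> step (s i) (q i) (q i.+1).
Proof.
split=> [[f Hf]|[q Hq]].
  exists (fun i => f (inord i)) => i ltin.
  apply: (step_hom Hf).
  have := @step_spath n s (inord i) (inord i.+1).
  by rewrite !inordK //; [apply|lia].
exists (fun i : 'I_n.+1 => q i) => i j /= /orP[] /andP[/eqP E]; rewrite E.
  move=> si; have := Hq i; rewrite si; apply.
  by have := ltn_ord j; rewrite /= E.
move=> /negbTE sj; have := Hq j; rewrite sj; apply.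
by have := ltn_ord i; rewrite /= E.
Qed.

Lemma spath_dist n s (q : nat -> 'I_n.+1) :
  (forall i, i < n -> @step (spath n s) (s i) (q i) (q i.+1)) ->
  forall i j, i <= j <= n -> q i <= q j + (j - i) /\ q j <= q i + (j - i).
Proof.
move=> Hq i j /andP[ij jn]; elim: j ij jn => [|j IH]; first by case: i => // _ _; lia.
rewrite leq_eqVlt => /orP[/eqP->|]; first by rewrite subnn; lia.
move=> ij jn; have {IH} := IH ij (ltnW jn).
have : (q j = (q j.+1).+1 :> nat) \/ (q j.+1 = (q j).+1 :> nat).
  have /step_uadj := Hq j jn.
  by rewrite /uadj /=; lia.
by lia.
Qed.

(** The image of a path is connected, so reaching both ends means being onto: the path is a core. *)
Definition tight n s : Prop :=
  forall q : nat -> 'I_n.+1,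
    (forall i, i < n -> @step (spath n s) (s i) (q i) (q i.+1)) ->
    (exists2 i, i <= n & q i = 0 :> nat) /\ (exists2 i, i <= n & q i = n :> nat).

Lemma hom_spath_walk n s m r (q : nat -> nat) :
  (forall i, i <= n -> q i <= m) ->
  (forall i, i < n -> (q i.+1 = (q i).+1 /\ s i = r (q i)) \/
                      (q i = (q i.+1).+1 /\ s i = ~~ r (q i.+1))) ->
  hom (spath n s) (spath m r).
Proof.
move=> Hm Hq; apply/hom_spathP; exists (fun i => inord (q i) : 'I_m.+1) => i ltin.
have [H1 H2] : q i <= m /\ q i.+1 <= m by split; apply: Hm; lia.
case: (Hq i ltin) => [[E ->]|[E ->]].
  rewrite -[X in r X](@inordK m) //.
  by apply: step_spath; rewrite !inordK.
rewrite step_negb -[X in r X](@inordK m) //.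
by apply: step_spath; rewrite !inordK.
Qed.

Lemma step_spathP n s d (i j : 'I_n.+1) :
  @step (spath n s) d i j ->
  (j = i.+1 :> nat /\ d = s i) \/ (i = j.+1 :> nat /\ d = ~~ s j).
Proof.
case: d => /= /orP[] /andP[/eqP E]; rewrite ?E => H; [left|right|right|left];
  by split=> //; move: H; case: (s _).
Qed.

(** An endomorphism that misses an end maps the path into the path without that end, which is
    equivalent and shorter. *)
Lemma tight_core n s :
  exists m r, [/\ hom (spath n s) (spath m r), hom (spath m r) (spath n s) & tight m r].
Proof.
elim: n s => [|n IH] s.
  exists 0, s; split; [by exists id|by exists id|].
  by move=> q _; split; exists 0 => //; rewrite (ord1 (q 0)).
have shrink r : hom (spath n.+1 s) (spath n r) -> hom (spath n r) (spath n.+1 s) ->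
    exists m r, [/\ hom (spath n.+1 s) (spath m r), hom (spath m r) (spath n.+1 s)
                  & tight m r].
  move=> H1 H2; have [m [r' [H3 H4 H5]]] := IH r.
  by exists m, r'; split=> //; [exact: hom_trans H3|exact: hom_trans H4 H2].
have [ti|] := classic (tight n.+1 s).
  by exists n.+1, s; split=> //; exists id.
move=> nti; have {nti} [q Hq miss] : exists2 q : nat -> 'I_n.+2,
    (forall i, i < n.+1 -> @step (spath n.+1 s) (s i) (q i) (q i.+1)) &
    (forall i, i <= n.+1 -> q i <> 0 :> nat) \/ (forall i, i <= n.+1 -> q i <> n.+1 :> nat).
  apply: NNPP => nex; apply: nti => q Hq; split; apply: NNPP => nhit; apply: nex;
    exists q => //; [left|right] => i Hi E; apply: nhit; by exists i.
case: miss => miss.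
  apply: (shrink (fun i => s i.+1)).
    apply: (hom_spath_walk (q := fun i => (q i).-1)) => [i Hi|i ltin].
      by have := ltn_ord (q i); lia.
    have := miss i (ltnW ltin); have := miss i.+1 ltin.
    by case: (step_spathP (Hq i ltin)) => [[E ->]|[E ->]] H1 H2; [left|right];
      split; rewrite ?prednK; try (congr (~~ s _)); lia.
  apply: (hom_spath_walk (q := succn)) => i Hi //; by left.
apply: (shrink s).
  apply: (hom_spath_walk (q := fun i => q i)) => [i Hi|i ltin].
    by have := miss i Hi; have := ltn_ord (q i); lia.
  exact: (step_spathP (Hq i ltin)).
apply: (hom_spath_walk (q := id)) => i Hi; [lia|by left].
Qed.

(** Each step moves the position by one, so visits to [0] and [n] need [n] steps between them: they
    occur at the two ends of the walk, which is then monotone. *)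
Lemma tight_selfhom n s (q : nat -> 'I_n.+1) :
  tight n s -> (forall i, i < n -> @step (spath n s) (s i) (q i) (q i.+1)) ->
  (forall i, i <= n -> q i = i :> nat) \/ (forall i, i <= n -> q i = n - i :> nat).
Proof.
move=> ti Hq; have [[a an qa] [b bn qb]] := ti q Hq.
have dist := spath_dist Hq.
have [/andP[/eqP a0 /eqP bn'] | /andP[/eqP b0 /eqP an']] :
    (a == 0) && (b == n) \/ (b == 0) && (a == n).
  case: (leqP a b) => ab; [have := dist a b|have := dist b a]; by lia.
- left=> i Hi; subst; have := dist 0 i; have := dist i n; lia.
- right=> i Hi; subst; have := dist 0 i; have := dist i n; lia.
Qed.

(** * The ladder *)

(* A map of a tree into the path is labelled by [true] at the vertices that end
   a copy of the initial segment below them; along the path the label can only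
   increase, and the label [true] at the last vertex would produce a copy of
   the whole path. *)
Definition rung n (u : 'I_n.+1 * bool) : bool :=
  ((u.1 == 0 :> nat) ==> u.2) && ((u.1 == n :> nat) ==> ~~ u.2).

Definition ladder (n : nat) (s : nat -> bool) : digraph :=
  @Digraph ('I_n.+1 * bool)%type (fun u v =>
    [&& rung u, rung v &
        ((v.1 == u.1.+1 :> nat) && s u.1 && (u.2 ==> v.2)) ||
        ((u.1 == v.1.+1 :> nat) && ~~ s v.1 && (v.2 ==> u.2))]).

Lemma step_ladder n s (u v : 'I_n.+1 * bool) :
  rung u -> rung v -> v.1 = u.1.+1 :> nat -> u.2 ==> v.2 ->
  @step (ladder n s) (s u.1) u v.
Proof.
move=> ru rv E imp; rewrite /step /= ru rv E eqxx imp.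
by case: (s u.1); rewrite //= orbT.
Qed.

Lemma ladder_fst n s : @is_hom (ladder n s) (spath n s) fst.
Proof.
move=> u v /and3P[_ _ /orP[] /andP[/andP[/eqP E H] _]] /=; rewrite E H eqxx //.
by rewrite orbT.
Qed.

Lemma step_ladderP n s d (u v : 'I_n.+1 * bool) :
  @step (ladder n s) d u v ->
  [/\ rung u, rung v & v.1 = u.1.+1 :> nat -> u.2 -> v.2].
Proof.
case: d => /= /and3P[H1 H2 H3]; split=> //;
  move: H3 => /orP[] /andP[/andP[/eqP E _] /implyP] //;
  move=> _ E'; lia.
Qed.

(** The projection to the path is the identity or the reversal, so there is a section. Its label is
    [true] over [0], stays [true], and is forbidden over [n]. *)
Lemma spath_ladder n s : 0 < n -> tight n s -> ~ hom (spath n s) (ladder n s).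
Proof.
move=> n0 ti /hom_spathP[q Hq].
suff [q' Hq' fstq'] : exists2 q' : nat -> dvert (ladder n s),
    (forall i, i < n -> step (s i) (q' i) (q' i.+1)) & forall i, i <= n -> (q' i).1 = i :> nat.
  have top i : i <= n -> (q' i).2.
    elim: i => [|i IH] Hi.
      have [/andP[+ _] _ _] := step_ladderP (Hq' 0 n0).
      by rewrite fstq'.
    have [_ _] := step_ladderP (Hq' i Hi); apply; last by apply: IH; lia.
    by rewrite !fstq' // ltnW.
  case: n n0 {ti Hq q} q' Hq' fstq' top => // n _ q' Hq' fstq' top.
  have [_ /andP[_ +] _] := step_ladderP (Hq' n (ltnSn n)).
  by rewrite fstq' // top // eqxx.
have Hq1 i : i < n -> @step (spath n s) (s i) (q i).1 (q i.+1).1.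
  by move=> Hi; apply: step_hom (@ladder_fst n s) (Hq i Hi).
have [H|H] := tight_selfhom ti Hq1; first by exists q.
(* The reversal being an endomorphism, [s (n - i.+1) = ~~ s i], so [q] read backwards is a
   section. *)
exists (fun i => q (n - i)) => [i Hi|i Hi]; last by rewrite H ?subKn // leq_subr.
have E1 : n - i = (n - i.+1).+1 by lia.
have Hi' : n - i.+1 < n by lia.
have := step_spathP (Hq1 _ Hi'); have := Hq _ Hi'; rewrite -E1 H ?H; try lia.
move=> + [[E _]|[_ E]]; first lia.
by rewrite E step_negb; congr (step (s _) _ _); lia.
Qed.

(** * Initial and final segments *)

(** Rooted at vertex [j] and read down to [0], hence the negated directions. *)
Fixpoint left_seg (s : nat -> bool) (j : nat) : ftree :=
  if j is j'.+1 then FNode FLeaf (~~ s j') (left_seg s j') else FLeaf.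

Fixpoint right_seg (s : nat -> bool) (j m : nat) : ftree :=
  if m is m'.+1 then FNode FLeaf (s j) (right_seg s j.+1 m') else FLeaf.

Lemma left_segP s j (X : digraph) (x : dvert X) :
  sat (left_seg s j) x ->
  exists2 q : nat -> dvert X, q j = x & forall i, i < j -> step (s i) (q i) (q i.+1).
Proof.
elim: j x => [|j IH] x; first by exists (fun=> x).
move=> /sat_nodeP[_ [y]]; rewrite step_negb => yx /IH[q qj Hq].
exists (fun i => if i <= j then q i else x) => [|i]; first by rewrite ltnn.
by case: (ltngtP i j) => [ij _|ji|-> _]; [exact: Hq|lia|rewrite qj].
Qed.

Lemma right_segP s j m (X : digraph) (x : dvert X) :
  sat (right_seg s j m) x ->
  exists2 q : nat -> dvert X, q j = x &
    forall i, j <= i < j + m -> step (s i) (q i) (q i.+1).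
Proof.
elim: m j x => [|m IH] j x; first by exists (fun=> x) => // i; lia.
move=> /sat_nodeP[_ [y xy /IH[q qj Hq]]].
exists (fun i => if i <= j then x else q i) => [|i]; first by rewrite leqnn.
have [|ji ijm|-> _] := ltngtP i j; first by lia.
  by apply: Hq; lia.
by rewrite qj.
Qed.

Lemma hom_of_segs n s j (X : digraph) (x : dvert X) :
  j <= n -> sat (left_seg s j) x -> sat (right_seg s j (n - j)) x -> hom (spath n s) X.
Proof.
move=> jn /left_segP[q1 q1j Hq1] /right_segP[q2 q2j Hq2]; apply/hom_spathP.
exists (fun i => if i <= j then q1 i else q2 i) => i ltin.
have [ij|ji|Eij] := ltngtP i j.
- exact: Hq1.
- by apply: Hq2; lia.
- by subst i; rewrite q1j -q2j; apply: Hq2; lia.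
Qed.

(** The label of [t] tells whether the initial segment up to [g t] can end at [t]; a step to the
    next position prolongs that segment. *)
Lemma tree_to_ladder n s (T : digraph) (g : dvert T -> 'I_n.+1) :
  @is_hom T (spath n s) g -> ~ hom (spath n s) T ->
  exists2 g' : dvert T -> dvert (ladder n s), is_hom g' & forall t, rung (g' t).
Proof.
move=> Hg nhom; pose g' t := (g t, sat (left_seg s (g t)) t).
have rg t : rung (g' t).
  rewrite /rung /=; apply/andP; split; apply/implyP => /eqP E; first by rewrite E.
  apply/negP; rewrite E => H; apply: nhom.
  by apply: (hom_of_segs (leqnn n) H); rewrite subnn.
exists g' => // x y xy /=; rewrite !rg /=.
have /orP[/andP[/eqP E sx]|/andP[/eqP E sy]] := Hg _ _ xy; apply/orP; [left|right].
  rewrite E eqxx sx /=; apply/implyP => Hx.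
  by apply/existsP; exists x; rewrite sx Hx /= xy.
rewrite E eqxx sy /=; apply/implyP => Hy.
by apply/existsP; exists y; rewrite (negbTE sy) Hy /= xy.
Qed.

Definition ladv n s (j : nat) (c : bool) : dvert (ladder n s) := (inord j, c).

Lemma step_ladv n s j c d :
  j < n -> (0 < j) || c -> (j.+1 < n) || ~~ d -> c ==> d ->
  step (s j) (ladv n s j c) (ladv n s j.+1 d).
Proof.
move=> jn Hc Hd cd; rewrite -{1}(@inordK n j) ?ltnS 1?ltnW //.
by apply: step_ladder; rewrite /rung //= ?inordK ?ltnS ?(ltnW jn) //;
  move: c d Hc Hd cd => [] []; lia.
Qed.

Lemma left_seg_ladder n s j : j < n -> sat (left_seg s j) (ladv n s j true).
Proof.
elim: j => // j IH Hj; apply: (sat_node (y := ladv n s j true)) => //.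
  by rewrite step_negb step_ladv ?orbT ?Hj //; lia.
by apply: IH; lia.
Qed.

Lemma right_seg_ladder n s j m : 0 < j -> j + m <= n ->
  sat (right_seg s j m) (ladv n s j false).
Proof.
elim: m j => // m IH j j0 Hj; apply: (sat_node (y := ladv n s j.+1 false)) => //.
  by rewrite step_ladv ?orbT ?j0 //; lia.
by apply: IH; lia.
Qed.

(** Label [false] spans the path on [1 .. n], label [true] the one on [0 .. n.-1]; the arc between
    [(1, false)] and [(2, true)] joins them. *)
Lemma rung_connect n s (u : dvert (ladder n s)) : 2 < n -> rung u ->
  connect (@uadj (ladder n s)) u (ladv n s 1 false).
Proof.
move=> n2; have csym := sym_connect_sym (@uadj_sym (ladder n s)).
have bot j : j < n -> connect (@uadj (ladder n s)) (ladv n s j.+1 false) (ladv n s 1 false).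
  elim: j => // j IH Hj; apply: connect_trans (IH (ltnW Hj)).
  rewrite csym; apply: connect1; apply: (@step_uadj _ (s j.+1)).
  by apply: step_ladv; rewrite ?orbT //; lia.
have top j : j < n -> connect (@uadj (ladder n s)) (ladv n s j true) (ladv n s 0 true).
  elim: j => // j IH Hj; apply: connect_trans (IH (ltnW Hj)).
  rewrite csym; apply: connect1; apply: (@step_uadj _ (s j)).
  by apply: step_ladv; rewrite ?orbT ?Hj //; lia.
case: u => j c /andP[/= H0 Hn].
have -> : (j, c) = ladv n s j c by rewrite /ladv inord_val.
case: c H0 Hn => [_ Hn|H0 _].
  have jn : j < n by have := ltn_ord j; lia.
  apply: (connect_trans (top j jn)); rewrite csym.
  apply: connect_trans (top 2 n2); apply: connect1; apply: (@step_uadj _ (s 1)).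
  by apply: step_ladv; rewrite ?n2 //; lia.
have := ltn_ord j; case: (nat_of_ord j) H0 => // k _ Hk; exact: bot.
Qed.

(** * The zigzag *)

(* The walk [a b d c a b d c ...] around the square of the ladder with [a] over
   [i], [b] and [c] over [i.+1] and [d] over [i.+2]. The final segment planted
   at each [b] and the initial segment at each [c] forbid identifying them in a
   digraph that does not receive the whole path. *)
Fixpoint zigzag (n : nat) (s : nat -> bool) (i k : nat) : ftree :=
  if k is k'.+1 then
    FNode FLeaf (s i)
      (FNode (right_seg s i.+1 (n - i.+1)) (s i)
         (FNode FLeaf (~~ s i)
            (FNode (left_seg s i.+1) (~~ s i) (zigzag n s i k'))))
  else FLeaf.

(** Around [b] or [c] a backtrack would give opposite arcs; around [a] or [d] it would identify a
    [b] with a [c], whose segments join to the whole path. *)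
Lemma zigzag_walk n s i k (X : digraph) (x : dvert X) :
  oriented X -> ~ hom (spath n s) X -> i < n -> sat (zigzag n s i k) x ->
  exists w : nat -> dvert X,
    [/\ w 0 = x, 0 < k -> sat (right_seg s i.+1 (n - i.+1)) (w 1),
        forall j, j < 4 * k -> uadj (w j) (w j.+1) &
        forall j, j.+2 <= 4 * k -> w j <> w j.+2].
Proof.
move=> ori nhom ltin; elim: k x => [|k IH] a.
  by exists (fun=> a); split=> // j; rewrite muln0.
move=> /sat_nodeP[_ [b ab /sat_nodeP[Rb [d bd /sat_nodeP[_ [c dc]]]]]].
move=> /sat_nodeP[Lc [a' ca' /IH[w [w0 Rw adjw nbw]]]].
rewrite !step_negb in dc ca'.
exists (fun j => match j with 0 => a | 1 => b | 2 => d | 3 => c | j.+4 => w j end).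
have sep y : sat (right_seg s i.+1 (n - i.+1)) y -> c <> y.
  by move=> Ry E; apply: nhom; apply: (hom_of_segs ltin Lc); rewrite E.
split=> // [] [|[|[|[|j]]]] Hj.
- exact: step_uadj ab.
- exact: step_uadj bd.
- by rewrite uadj_sym; exact: step_uadj dc.
- by rewrite w0 uadj_sym; exact: step_uadj ca'.
- by apply: adjw; lia.
- by move=> E; rewrite -E in bd; exact: step_asym ori ab bd.
- by move=> E; exact: (sep b).
- by rewrite w0 => E; rewrite E in dc; exact: step_asym ori ca' dc.
(* [w 1] is the [b] of the next turn; the clause on it is carried along for this case. *)
- by apply: sep; apply: Rw; lia.
- by apply: nbw; lia.
Qed.

(** The corners are [a = (i, false)], [b = (i.+1, false)], [d = (i.+2, true)] and
    [c = (i.+1, true)]; the bounds on [i] keep them on rungs. *)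
Lemma zigzag_ladder n s i k : 0 < i -> i.+2 < n -> s i.+1 = s i ->
  sat (zigzag n s i k) (ladv n s i false).
Proof.
move=> i0 i2n eqs; elim: k => // k IH.
apply: (sat_node (y := ladv n s i.+1 false)) => //; first by rewrite step_ladv //; lia.
apply: (sat_node (y := ladv n s i.+2 true)); first by apply: right_seg_ladder; lia.
  by rewrite -eqs step_ladv //; lia.
apply: (sat_node (y := ladv n s i.+1 true)) => //.
  by rewrite step_negb -eqs step_ladv //; lia.
apply: (sat_node (y := ladv n s i false)) => //; first by apply: left_seg_ladder; lia.
by rewrite step_negb step_ladv //; lia.
Qed.

(** [psi] is [phi] at the end of a walk from [u] to [v], which allows [phi] to be attached at a
    distance. *)
Lemma connect_sat (X : digraph) (phi : ftree) (u v : dvert X) :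
  connect (@uadj X) u v -> sat phi v ->
  exists2 psi, sat psi u &
    forall (Y : digraph) (y : dvert Y), sat psi y ->
      exists y' : dvert Y, sat phi y'.
Proof.
move=> /connectP[p]; elim: p u => [|w p IH] u /=.
  by move=> _ -> Hv; exists phi => // Y y ?; exists y.
case/andP=> /uadjP[d uw] pth lst Hv; have [psi Hpsi ex] := IH w pth lst Hv.
exists (FNode FLeaf d psi); first exact: sat_node uw Hpsi.
by move=> Y y /sat_nodeP[_ [z _ /ex]].
Qed.

(** * Height and the intermediate tree *)

Lemma straight_inner n s :
  (forall k, hom (spath n s) (dipath k) -> 4 <= k) ->
  exists i, [/\ 0 < i, i.+2 < n & s i.+1 = s i].
Proof.
move=> h4; apply: NNPP => nex.
have alt i : 0 < i -> i.+2 < n -> s i.+1 = ~~ s i.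
  move=> i0 Hi; apply/eqP; rewrite -[_ == _]negbK; apply/negP => H; apply: nex; exists i.
  by split=> //; move: H; case: (s i); case: (s i.+1).
have salt i : i.+2 < n -> s i.+1 = s 1 (+) odd i.
  elim: i => [|i IH] Hi; first by rewrite addbF.
  by rewrite alt // IH ?(ltnW Hi) //= addbN.
(* All the inner vertices alternate between the levels 1 and 2. *)
pose lv i := if s 1 (+) odd i then 2 else 1.
(* Each end sits one level off its neighbour, as its arc dictates; for [n = 1] only vertex [0] is
   adjusted. *)
pose q i := if i == 0 then (if s 0 then (lv 1).-1 else (lv 1).+1) else
            if (i == n) && (1 < n) then
              (if s n.-1 then (lv n.-1).+1 else (lv n.-1).-1) else lv i.
suff: hom (spath n s) (dipath 3) by move/h4.
apply/hom_spathP; exists (fun i => inord (q i) : dvert (dipath 3)) => i ltin.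
have q3 j : q j <= 3 by rewrite /q /lv; do !case: ifP.
rewrite /step /= !inordK ?ltnS ?q3 //.
case: i ltin => [|i] ltin.
  have -> : q 1 = lv 1 by rewrite /q /=; case: ifP => //; lia.
  by rewrite /q /lv /=; case: (s 0); case: (s 1).
have -> : q i.+1 = lv i.+1 by rewrite /q /=; case: ifP => //; lia.
have [E|/eqP ne] := eqVneq i.+2 n.
  by rewrite /q -E eqxx /= /lv; case: (s i.+1); case: ifP.
rewrite salt; last by lia.
have -> : q i.+2 = lv i.+2 by rewrite /q /=; case: ifP => //; lia.
by rewrite /lv /=; case: (s 1); case: (odd i).
Qed.

Lemma oriented_path_spath (P : digraph) :
  oriented_path P -> exists n s, hom P (spath n s) /\ hom (spath n s) P.
Proof.
move=> [n [p [[p' pK p'K] Hxor Harc]]].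
pose s i := darc (p (inord i)) (p (inord i.+1)).
exists n, s; split.
  exists p' => x y xy; have [i [Hi /=]] := Harc x y xy.
  have Ei : inord i = i by rewrite inord_val.
  have Ej : inord i.+1 = Ordinal Hi by apply: val_inj; rewrite /= inordK.
  have Hx := Hxor i Hi.
  case/orP=> /andP[/eqP Ex /eqP Ey]; rewrite Ex Ey !pK /= eqxx /s Ei Ej.
    by rewrite -Ex -Ey xy.
  by move: Hx; rewrite /= -Ex -Ey xy addbT => ->; rewrite orbT.
apply/hom_spathP; exists (fun i => p (inord i)) => i Hi.
have Hi' : (inord i : 'I_n.+1).+1 < n.+1 by rewrite inordK; lia.
have := Hxor (inord i) Hi'; rewrite /=.
have -> : Ordinal Hi' = inord i.+1 by apply: val_inj; rewrite /= !inordK //; lia.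
by rewrite /step /s; case: (darc (p (inord i)) _).
Qed.

Theorem theorem5 (T1 P2 : digraph) :
  oriented_tree T1 -> oriented_path P2 -> hlt T1 P2 ->
  (exists k, height P2 k /\ (4 <= k)%N) ->
  exists T : digraph, [/\ oriented_tree T, hlt T1 T & hlt T P2].
Proof.
move=> tT1 /oriented_path_spath[n0 [s0 [HP1 HP2]]] [T1P nPT1] [k0 [[_ k0min] k04]].
have [n [s [H1 H2 ti]]] := tight_core n0 s0.
have PtoS : hom P2 (spath n s) := hom_trans HP1 H1.
have StoP : hom (spath n s) P2 := hom_trans H2 HP2.
have [i [i0 i2n eqs]] : exists i, [/\ 0 < i, i.+2 < n & s i.+1 = s i].
  apply: straight_inner => k /(hom_trans PtoS) /k0min; exact: leq_trans.
have nST1 : ~ hom (spath n s) T1 by move=> /(hom_trans PtoS).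
have [g0 Hg0] : hom T1 (spath n s) := hom_trans T1P PtoS.
have [g Hg rungg] := tree_to_ladder Hg0 nST1.
have [ori /card_gt0P[x0 _] _ _] := tT1.
(* With [#|dvert T1|] turns the walk has four times as many steps, enough for a repetition in
   [T1]. *)
have Hzig := zigzag_ladder (#|dvert T1|) i0 i2n eqs.
have con : connect (@uadj (ladder n s)) (g x0) (ladv n s i false).
  apply: (connect_trans (rung_connect _ (rungg x0))); first by lia.
  rewrite (sym_connect_sym (@uadj_sym _)); apply: rung_connect; first by lia.
  by rewrite /rung /= inordK; lia.
have [psi Hpsi psiP] := connect_sat con Hzig.
have [U [io [tU Hio satU ext]]] := attach_tree psi x0 tT1.
have [h Hh _] := ext _ g Hg Hpsi.
have UL : hom U (ladder n s) by exists h.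
exists U; split=> //; split.
- by exists io.
- move=> [f Hf]; have [y /(sat_hom Hf) Hy] := psiP U (io x0) satU.
  have [w [_ _ adjw nbw]] := zigzag_walk ori nST1 (ltnW (ltnW i2n)) Hy.
  by apply: (no_long_nonbacktracking_walk tT1 _ adjw nbw); lia.
- by apply: (hom_trans UL); apply: hom_trans StoP; exists fst; exact: ladder_fst.
- move=> PU; apply: (spath_ladder _ ti); first by lia.
  exact: hom_trans StoP (hom_trans PU UL).
Qed.
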